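(* Let $n\ge 2$ and $k\ge 2$. Let $\mathcal{U}_k$ be the set of matrices $X=(x_{ij})_{1\le i,j\le n}\in\mathbf{U}(n,\mathbb{N})$ such that $k\le\max_{1\le i,j\le n}x_{ij}<2k$ and exactly one entry of $X$ is not contained in $\{0,\dots,k-1\}$. Then $\mathcal{U}_k$ is the unique minimal generating set for the monoid $\mathbf{U}(n,\mathbb{N})_k$. In particular, the embedding dimension of $\mathbf{U}(n,\mathbb{N})_k$ is $$\mathtt{e}(\mathbf{U}(n,\mathbb{N})_k)=\binom{n}{2}k^{\binom{n}{2}}.$$
   Context: $\mathbb{N}=\{0,1,2,\dots\}$. $\mathbf{U}(n,\mathbb{N})$ is the monoid under matrix multiplication of upper triangular $n\times n$ matrices with entries in $\mathbb{N}$ and all diagonal entries equal to $1$. $\mathbf{U}(n,\mathbb{N})_k:=\{\mathbf{1}_n\}\cup\{(x_{ij})\in\mathbf{U}(n,\mathbb{N}):k\le\max_{1\le i,j\le n}x_{ij}\}$, where $\mathbf{1}_n$ is the identity matrix; it is a submonoid of $\mathbf{U}(n,\mathbb{N})$. A generating set of a monoid is a subset such that every element is a (possibly empty) product of elements of the subset; minimal means minimal with respect to inclusion. The embedding dimension $\mathtt{e}(S)$ of a monoid $S$ is the minimum cardinality of a generating set of $S$. *)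

(* Defs.v *)
From HB Require Import structures.
From mathcomp Require Import all_boot all_algebra.
From mathcomp Require Import classical_sets cardinality.

Set Implicit Arguments.
Unset Strict Implicit.
Unset Printing Implicit Defensive.

Import GRing.Theory.

Section MonoidNotions.
Local Open Scope group_scope.
Local Open Scope classical_set_scope.
Local Open Scope card_scope.
Variable S : monoidType.
Implicit Types G H : set S.

(* The sequence [s] may be empty, and its empty product is [1]. *)
Definition generating_set G : Prop :=
  forall x : S, exists2 s : seq S,
    (forall y, y \in s -> G y) & x = \prod_(y <- s) y.

Definition minimal_generating_set G : Prop :=
  generating_set G /\
  forall H, H `<=` G -> generating_set H -> H = G.

(* A relation rather than a function, since the minimum cardinality of a
   generating set need not be finite: [embedding_dimension d] means that this
   minimum is the natural number [d]. *)
Definition embedding_dimension (d : nat) : Prop :=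
  (exists2 G, generating_set G & G #= `I_d) /\
  (forall G, generating_set G -> `I_d #<= G).

End MonoidNotions.

Arguments embedding_dimension S d : clear implicits.

Definition max_entry n (X : 'M[nat]_n) : nat :=
  \max_(i < n) \max_(j < n) X i j.

(* [is_trig_mx] means lower triangular, hence the transpose. *)
Definition upper_unitriangular n (X : 'M[nat]_n) : bool :=
  is_trig_mx X^T && [forall i, X i i == 1].

Record UN (n : nat) : predArgType := MkUN {
  UN_val :> 'M[nat]_n;
  UN_valP : upper_unitriangular UN_val }.

HB.instance Definition _ n := [isSub of UN n for @UN_val n].
HB.instance Definition _ n := [Choice of UN n by <:].

Section UNMonoid.
Variable n : nat.
Implicit Types X Y Z : UN n.

Lemma UN_lower X (i j : 'I_n) : j < i -> X i j = 0.
Proof.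
move=> ji; have /andP[/is_trig_mxP/(_ j i ji) + _] := UN_valP X.
by rewrite mxE.
Qed.

Lemma UN_diag X (i : 'I_n) : X i i = 1.
Proof. by have /andP[_ /forallP/(_ i)/eqP] := UN_valP X. Qed.

Lemma UN_one_subproof : upper_unitriangular (1%:M : 'M[nat]_n)%R.
Proof.
apply/andP; split; last by apply/forallP => i; rewrite mxE eqxx.
by apply/is_trig_mxP => i j ij; rewrite !mxE -val_eqE gtn_eqF.
Qed.

Lemma UN_mul_subproof X Y : upper_unitriangular (X *m Y)%R.
Proof.
apply/andP; split.
  apply/is_trig_mxP => i j ij; rewrite !mxE; apply: big1 => l _.
  case: (ltnP l j) => [lj|jl]; first by rewrite (UN_lower X lj) mul0r.
  by rewrite (UN_lower Y (leq_trans ij jl)) mulr0.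
apply/forallP => i; rewrite mxE (bigD1 i) //= !UN_diag big1 // => l.
rewrite -val_eqE neq_ltn => /orP[li|il].
  by rewrite (UN_lower X li) mul0r.
by rewrite (UN_lower Y il) mulr0.
Qed.

Definition UN_one : UN n := MkUN UN_one_subproof.
Definition UN_mul X Y : UN n := MkUN (UN_mul_subproof X Y).

Fact UN_mulA : associative UN_mul.
Proof. by move=> X Y Z; apply: val_inj; rewrite /= mulmxA. Qed.

Fact UN_mul1 : left_id UN_one UN_mul.
Proof. by move=> X; apply: val_inj; rewrite /= mul1mx. Qed.

Fact UN_mulr1 : right_id UN_one UN_mul.
Proof. by move=> X; apply: val_inj; rewrite /= mulmx1. Qed.

HB.instance Definition _ := isMonoid.Build (UN n) UN_mulA UN_mul1 UN_mulr1.

Lemma UN_le_mull X Y (i j : 'I_n) : X i j <= (X * Y)%g i j.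
Proof. by rewrite mxE (bigD1 j) //= UN_diag mulr1; apply: leq_addr. Qed.

Lemma max_entry_mull X Y : max_entry X <= max_entry (X * Y)%g.
Proof.
apply/bigmax_leqP => i _; apply/bigmax_leqP => j _.
apply: leq_trans (UN_le_mull X Y i j) _.
apply: leq_trans (leq_bigmax i).
exact: (leq_bigmax (F := fun j => (X * Y)%g i j)).
Qed.

End UNMonoid.

Definition UN_ge n (k : nat) : {pred UN n} :=
  [pred X : UN n | (X == 1%g) || (k <= max_entry X)].

Record UNk (n k : nat) : predArgType := MkUNk {
  UNk_val :> UN n;
  UNk_valP : UNk_val \in UN_ge k }.

HB.instance Definition _ n k := [isSub of UNk n k for @UNk_val n k].
HB.instance Definition _ n k := [Choice of UNk n k by <:].

Fact UN_ge_monoid_closed n k : monoid_closed (@UN_ge n k).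
Proof.
split=> [|X Y]; rewrite !inE ?eqxx // => /orP[/eqP->|kX].
  by rewrite mul1g.
by move=> _; rewrite (leq_trans kX (max_entry_mull X Y)) orbT.
Qed.

HB.instance Definition _ n k :=
  SubChoice_isSubMonoid.Build (UN n) (@UN_ge n k) (UNk n k)
    (@UN_ge_monoid_closed n k).

(* Letting [X] range over [UNk n k] instead of [UN n] loses nothing, because of
   the condition [k <= max_entry X]. *)
Definition Uk (n k : nat) : set (UNk n k) :=
  [set X : UNk n k | k <= max_entry X < 2 * k /\
           #|[pred p : 'I_n * 'I_n | ~~ (X p.1 p.2 < k)]| = 1]%classic.

Arguments Uk n k : clear implicits.

(* Main.v *)
Require Import Defs.
From mathcomp Require Import all_boot all_algebra.
From mathcomp Require Import classical_sets cardinality.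
From mathcomp Require Import boolp zify.

(** For [Y, Z] in [U(n, N)] one has [(Y * Z) i j >= Y i j + Z i j] above the
    diagonal.  Hence a product of two non-identity elements of [U(n, N)_k] has
    either two entries [>= k] or one entry [>= 2k], so the elements of [U_k] are
    irreducible and lie in every generating set.  Conversely, write a
    non-identity [X] outside [U_k] as [1 + A + B] where [A] is supported in
    columns [>= j], [B] in columns [<= j], and each has an entry [>= k].  Then
    [A *m B = 0], so [X = (1 + A) * (1 + B)], and both factors have a smaller sum
    of entries. *)

Set Implicit Arguments.
Unset Strict Implicit.
Unset Printing Implicit Defensive.

(** * Large entries and products of unitriangular matrices *)

Lemma max_entry_geP n (X : 'M[nat]_n) m : 0 < m ->
  reflect (exists p : 'I_n * 'I_n, m <= X p.1 p.2) (m <= max_entry X).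
Proof.
case: m => // m _; apply: (iffP idP) => [|[[i j] /= mX]]; last first.
  apply: leq_trans mX (leq_trans _ (leq_bigmax i)).
  exact: (leq_bigmax (F := fun j => X i j)).
have [/existsP[p mX] _|/existsPn Xm] := boolP [exists p, m < X p.1 p.2].
  by exists p.
rewrite ltnNge => /negP[].
apply/bigmax_leqP => i _; apply/bigmax_leqP => j _.
by have := Xm (i, j); rewrite -leqNgt.
Qed.

Section UnitriangularMatrices.
Variable n : nat.
Implicit Types X Y Z : UN n.

Lemma UN_eqP X Y : (forall i j : 'I_n, i < j -> X i j = Y i j) -> X = Y.
Proof.
move=> eqXY; apply: val_inj; apply/matrixP => i j /=.
case: (ltngtP i j) => [/eqXY //|ji|/val_inj->]; first by rewrite !UN_lower.
by rewrite !UN_diag.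
Qed.

Lemma UN_one_le1 (i j : 'I_n) : (1%g : UN n) i j <= 1.
Proof. by rewrite mxE; case: eqP. Qed.

(** Since [1 < k], this places every entry that is at least [k] strictly above the diagonal. *)
Lemma UN_gt1_lt X (i j : 'I_n) : 1 < X i j -> i < j.
Proof.
by case: (ltngtP i j) => // [ji|/val_inj->]; rewrite ?(UN_lower _ ji) ?UN_diag.
Qed.

Lemma UN_mulE Y Z (i j : 'I_n) : i < j ->
  (Y * Z)%g i j = Y i j + Z i j + \sum_(l < n | i < l < j) Y i l * Z l j.
Proof.
move=> ij; transitivity (\sum_l Y i l * Z l j); first by rewrite mxE.
rewrite (bigD1 i) //= (bigD1 j) /=; last by rewrite -val_eqE /= gtn_eqF.
rewrite !UN_diag mul1n muln1 addnA [Z i j + _]addnC; congr (_ + _).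
rewrite (bigID (fun l : 'I_n => i < l < j)) /= [X in _ + X]big1 ?addn0.
  apply: eq_bigl => l; rewrite -!val_eqE /=.
  apply/idP/idP => [/andP[]//|/andP[il lj]].
  by rewrite il lj gtn_eqF // ltn_eqF.
move=> l; rewrite -!val_eqE /= negb_and -!leqNgt => /andP[/andP[li lj]].
case/orP => [il|jl].
  by rewrite (UN_lower Y) ?mul0n // ltn_neqAle li.
by rewrite (UN_lower Z) ?muln0 // ltn_neqAle eq_sym lj.
Qed.

Definition UN_fun_mx (f : 'I_n -> 'I_n -> nat) : 'M[nat]_n :=
  \matrix_(i, j) (if i < j then f i j else i == j)%N.

Lemma UN_fun_subproof f : upper_unitriangular (UN_fun_mx f).
Proof.
apply/andP; split; last by apply/forallP => i; rewrite mxE ltnn eqxx.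
apply/is_trig_mxP => i j ij; rewrite !mxE ltnNge (ltnW ij) /=.
by rewrite -val_eqE gtn_eqF.
Qed.

Definition UN_fun f : UN n := MkUN (UN_fun_subproof f).

Lemma UN_funE f (i j : 'I_n) : i < j -> UN_fun f i j = f i j.
Proof. by move=> ij; rewrite mxE ij. Qed.

(** The left factor takes the columns after [p.2] and, if [q] lies in column [p.2], the amount [k]
    from the entry at [q]; the right factor takes the rest. When [p = q], one entry has to supply
    [k] to both factors, whence the bound [2 * k]. *)
Lemma UN_split_column X (p q : 'I_n * 'I_n) k : 1 < k ->
    k <= X p.1 p.2 -> k <= X q.1 q.2 -> p.2 <= q.2 ->
    (p = q -> 2 * k <= X p.1 p.2) ->
  exists Y Z, [/\ X = (Y * Z)%g, k <= Y q.1 q.2 & k <= Z p.1 p.2].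
Proof.
move=> k1 kp kq pq pqX.
pose A (i j : 'I_n) :=
  if p.2 < j then X i j else if (i, j) == q then k else 0.
(* This makes the truncated subtraction in [B] exact, so that [A] and [B] add up to [X]. *)
have AX i j : A i j <= X i j.
  by rewrite /A; case: ifP => // _; case: eqP => // eq_q; rewrite -eq_q in kq.
pose B i j := X i j - A i j.
have ltp : p.1 < p.2 by apply: (UN_gt1_lt (X := X)); apply: leq_trans kp.
have ltq : q.1 < q.2 by apply: (UN_gt1_lt (X := X)); apply: leq_trans kq.
exists (UN_fun A), (UN_fun B); split.
- apply: UN_eqP => i j ij.
  rewrite UN_mulE // !UN_funE // /B subnKC // big1 ?addn0 //.
  (* The left factor is supported in columns [>= p.2], the right one in columns
     [<= p.2], so [i < l < j] leaves no nonzero cross term. *)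
  move=> l /andP[il lj]; rewrite !UN_funE // /A.
  have [jp|pj] := leqP j p.2; last by rewrite subnn muln0.
  have lp := leq_trans lj jp.
  rewrite ltnNge (ltnW lp) /=.
  by case: eqP => // E; rewrite -E /= leqNgt lp in pq.
- by rewrite UN_funE // /A -surjective_pairing eqxx; case: ifP.
- rewrite UN_funE // /B /A ltnn -surjective_pairing.
  by case: eqP => [/pqX|_]; lia.
Qed.

End UnitriangularMatrices.

(** * Irreducibility of the elements of [Uk], and generation by them *)

Section Generation.
Variables n k : nat.
Hypothesis k_gt1 : 1 < k.
Implicit Types X Y Z : UNk n k.

Let k_gt0 : 0 < k := ltnW k_gt1.

Lemma UNk_neq1 X : X <> 1%g -> exists p : 'I_n * 'I_n, k <= X p.1 p.2.
Proof.
move=> X1; apply/(max_entry_geP X k_gt0).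
by have /orP[/eqP eX|//] := UNk_valP X; case: X1; apply: val_inj.
Qed.

Lemma UNk_mulE_ge Y Z (i j : 'I_n) : i < j -> Y i j + Z i j <= (Y * Z)%g i j.
Proof. by move=> ij; rewrite (UN_mulE Y Z ij) leq_addr. Qed.

Lemma Uk_neq1 X : Uk n k X -> X <> 1%g.
Proof.
move=> [/andP[/(max_entry_geP X k_gt0)[p +] _] _] X1.
by rewrite X1 leqNgt (leq_ltn_trans (UN_one_le1 _ _) k_gt1).
Qed.

Lemma Uk_irreducible X Y Z : Uk n k X -> X = (Y * Z)%g -> Y = 1%g \/ Z = 1%g.
Proof.
move=> [/andP[_ X2k] X1] eX.
have [->|/eqP/UNk_neq1[p kY]] := eqVneq Y 1%g; first by left.
have [->|/eqP/UNk_neq1[q kZ]] := eqVneq Z 1%g; first by right.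
have ge r := UNk_mulE_ge Y Z (i := r.1) (j := r.2).
have ltp : p.1 < p.2 by apply: (UN_gt1_lt (X := Y)); apply: leq_trans kY.
have ltq : q.1 < q.2 by apply: (UN_gt1_lt (X := Z)); apply: leq_trans kZ.
have gep := ge p ltp; have geq := ge q ltq; rewrite -eX in gep geq.
have /card_le1_eqP eq_large := eq_leq X1.
(* The large entries of [Y] and [Z] both persist in [X], which has only one; there they add up to at
   least [2 * k]. *)
have pq : p = q by apply: eq_large; rewrite inE -leqNgt; lia.
move: X2k; rewrite ltnNge => /negP[]; apply/max_entry_geP; first lia.
by exists p; rewrite -pq in kZ; lia.
Qed.

Lemma Uk_sub_generating (G : set (UNk n k)) :
  generating_set G -> (Uk n k `<=` G)%classic.
Proof.
move=> genG X UX; have [s sG eX] := genG X.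
apply: sG; elim: s eX => [|Y s IHs]; rewrite ?big_nil ?big_cons => eX.
  by case: (Uk_neq1 UX).
rewrite inE; have [Y1|s1] := Uk_irreducible UX eX.
  by rewrite IHs ?orbT // eX Y1 mul1g.
by rewrite eX s1 mulg1 eqxx.
Qed.

Lemma UNk_reducible X : X <> 1%g -> ~ Uk n k X ->
  exists Y Z, [/\ X = (Y * Z)%g, Y <> 1%g & Z <> 1%g].
Proof.
move=> X1 nUX.
have [p [q [kp kq le_pq pqX]]] : exists p q : 'I_n * 'I_n,
    [/\ k <= X p.1 p.2, k <= X q.1 q.2, p.2 <= q.2
      & p = q -> 2 * k <= X p.1 p.2].
  have [p kp] := UNk_neq1 X1.
  (* Two large positions are ordered by column. A single one is taken twice: were its entry below
     [2 * k], [X] would lie in [Uk]. *)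
  have [[q [qp kq]]|only_p] :=
      pselect (exists q : 'I_n * 'I_n, q <> p /\ k <= X q.1 q.2).
    by case: (leqP p.2 q.2) => pq; [exists p, q|exists q, p];
      split=> //; [move/esym|exact: ltnW].
  have only q : k <= X q.1 q.2 -> q = p.
    by move=> kq; apply: contrapT => qp; apply: only_p; exists q.
  exists p, p; split=> // _; rewrite leqNgt; apply/negP => p2k.
  apply: nUX; split.
    apply/andP; split; first by apply/max_entry_geP => //; exists p.
    rewrite ltnNge; apply/negP => /max_entry_geP[|q q2k]; first lia.
    by have qp : q = p by [apply: only; lia]; rewrite qp in q2k; lia.
  apply/eqP; rewrite -(card1 p); apply/eqP; apply: eq_card => q.
  by rewrite !inE -leqNgt; apply/idP/eqP => [/only|->].
have [Y [Z [eX kY kZ]]] := UN_split_column k_gt1 kp kq le_pq pqX.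
have ge (W : UN n) (r : 'I_n * 'I_n) : k <= W r.1 r.2 -> W \in UN_ge k.
  move=> kW; rewrite inE; apply/orP; right.
  by apply/max_entry_geP => //; exists r.
have neq1 (W : UN n) (r : 'I_n * 'I_n) : k <= W r.1 r.2 -> W <> 1%g.
  move=> kW W1; move: kW.
  by rewrite W1 leqNgt (leq_ltn_trans (UN_one_le1 _ _) k_gt1).
exists (MkUNk (ge _ _ kY)), (MkUNk (ge _ _ kZ)); split.
- exact: val_inj.
- by move/(congr1 val); apply: neq1 kY.
- by move/(congr1 val); apply: neq1 kZ.
Qed.

(** The sum of entries is the induction measure for factoring. It grows strictly from one factor to
    the product because of a large entry of the other factor. *)
Lemma UNk_mul_sum_lt Y Z : Y <> 1%g -> Z <> 1%g ->
  \sum_i \sum_j Y i j < \sum_i \sum_j (Y * Z)%g i j /\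
  \sum_i \sum_j Z i j < \sum_i \sum_j (Y * Z)%g i j.
Proof.
move=> Y1 Z1.
have lt (W V : 'M[nat]_n) : (forall i j, W i j <= V i j) ->
    (exists p : 'I_n * 'I_n, W p.1 p.2 < V p.1 p.2) ->
  \sum_i \sum_j W i j < \sum_i \sum_j V i j.
  move=> le [p ltp]; rewrite !pair_big /= [ltnRHS](bigD1 p) //= (bigD1 p) //=.
  by rewrite -addSn leq_add // leq_sum.
have le (i j : 'I_n) : Y i j <= (Y * Z)%g i j /\ Z i j <= (Y * Z)%g i j.
  case: (ltngtP i j) => [/(UNk_mulE_ge Y Z)|ji|/val_inj->]; first by lia.
    by rewrite !UN_lower.
  by rewrite !UN_diag.
have [p kY] := UNk_neq1 Y1; have [q kZ] := UNk_neq1 Z1.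
have ltp : p.1 < p.2 by apply: (UN_gt1_lt (X := Y)); apply: leq_trans kY.
have ltq : q.1 < q.2 by apply: (UN_gt1_lt (X := Z)); apply: leq_trans kZ.
have := UNk_mulE_ge Y Z ltp; have := UNk_mulE_ge Y Z ltq => geq gep.
split; apply: lt.
- by move=> i j; case: (le i j).
- by exists q; lia.
- by move=> i j; case: (le i j).
- by exists p; lia.
Qed.

Lemma Uk_generating : generating_set (Uk n k).
Proof.
move=> X; have [m] := ubnP (\sum_i \sum_j X i j).
elim: m X => // m IHm X ltX.
have [->|/eqP X1] := eqVneq X 1%g; first by exists [::]; rewrite ?big_nil.
have [UX|nUX] := pselect (Uk n k X).
  by exists [:: X]; rewrite ?big_seq1 // => Y; rewrite inE => /eqP->.
have [Y [Z [eX Y1 Z1]]] := UNk_reducible X1 nUX.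
have [ltY ltZ] := UNk_mul_sum_lt Y1 Z1; rewrite -eX in ltY ltZ.
have [s sU eY] := IHm Y (leq_trans ltY ltX).
have [t tU eZ] := IHm Z (leq_trans ltZ ltX).
exists (s ++ t); last by rewrite big_cat -eY -eZ.
by move=> W; rewrite mem_cat => /orP[/sU|/tU].
Qed.

End Generation.

(** * Counting the elements of [Uk] *)

Lemma card_ltn_ord_pairs n :
  #|{: {p : 'I_n * 'I_n | p.1 < p.2}}| = 'C(n, 2).
Proof.
rewrite card_sig -sum1_card.
rewrite -(pair_big_dep xpredT (fun i j : 'I_n => i < j) (fun _ _ => 1)) /=.
(* Count by the larger index [j]: it leaves [j] choices for the smaller one. *)
rewrite (exchange_big_dep xpredT) //= -bin2_sum big_mkord.
apply: eq_bigr => j _; rewrite sum1_card -[RHS]card_ord.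
have wj : injective (widen_ord (ltnW (ltn_ord j))).
  by move=> a b /(congr1 val) /= /val_inj.
rewrite -(fintype.card_image wj).
apply: eq_card => i; rewrite unfold_in -/(i < j).
apply/idP/fintype.imageP => [ij|[l _ ->]]; last exact: (ltn_ord l).
by exists (Ordinal ij) => //; apply: val_inj.
Qed.

Section Counting.
Variables n k : nat.
Hypothesis k_gt1 : 1 < k.

Let T := {p : 'I_n * 'I_n | p.1 < p.2}.

Let code : Type := T * {ffun T -> 'I_k}.
Implicit Type c : code.

(* The code [(t, f)] stands for the matrix whose only entry [>= k] is at [t], and
   whose entries modulo [k] are given by [f]. *)
Definition code_entry c (i j : 'I_n) : nat :=
  if insub (i, j) is Some t then c.2 t + (c.1 == t) * k else 0.

Lemma code_entryE c (t : T) :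
  UN_fun (code_entry c) (val t).1 (val t).2 = c.2 t + (c.1 == t) * k.
Proof.
rewrite UN_funE; last exact: valP t.
by rewrite /code_entry -surjective_pairing valK.
Qed.

Lemma decode_subproof c : UN_fun (code_entry c) \in UN_ge k.
Proof.
rewrite inE; apply/orP; right; apply/max_entry_geP; first exact: ltnW.
by exists (val c.1); rewrite code_entryE eqxx mul1n leq_addl.
Qed.

Definition decode (c : code) : UNk n k := MkUNk (decode_subproof c).

Lemma code_entry_ge c (t : T) : (k <= c.2 t + (c.1 == t) * k) = (c.1 == t).
Proof. by have := ltn_ord (c.2 t); case: eqP => _; lia. Qed.

(** The position is recovered as that of the only large entry; cancelling the common [k] then leaves
    equal residues. *)
Lemma decode_inj : injective decode.
Proof.
move=> c d /(congr1 (fun X : UNk n k => X : 'M_n)) /= cd.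
have E t : c.2 t + (c.1 == t) * k = d.2 t + (d.1 == t) * k.
  by rewrite -!code_entryE /= cd.
have eq1 : c.1 = d.1.
  by apply/esym/eqP; rewrite -code_entry_ge -E code_entry_ge.
case: c d eq1 E {cd} => [t f] [u g] /= -> E; congr (_, _).
by apply/ffunP => v; apply: val_inj; apply: addIn (E v).
Qed.

Lemma decode_large c (p : 'I_n * 'I_n) :
  (k <= decode c p.1 p.2) = (p == val c.1).
Proof.
have [pp|pp] := ltnP p.1 p.2.
  by rewrite -[p]/(val (exist _ p pp : T)) code_entryE code_entry_ge eq_sym.
have -> : (p == val c.1) = false.
  by apply: contraTF pp => /eqP->; rewrite -ltnNge; apply: valP c.1.
apply: contraTF pp => kp; rewrite -ltnNge.
by apply: (UN_gt1_lt (X := decode c)); apply: leq_trans kp.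
Qed.

(** An entry below [k] is its own residue modulo [k], and the large one, lying in [[k, 2k)], is its
    residue plus [k]. Position and residues thus determine a matrix of [Uk]. *)
Lemma Uk_eq_decode : Uk n k = (decode @` setT)%classic.
Proof.
apply/seteqP; split=> [X [/andP[_ X2k] X1]|_ [c _ <-]]; last first.
  split; last first.
    rewrite -(card1 (val c.1)); apply: eq_card => p.
    by rewrite !inE -leqNgt decode_large.
  have large := decode_large c.
  apply/andP; split.
    by apply/max_entry_geP; [lia|exists (val c.1); rewrite large].
  rewrite ltnNge; apply/negP => /max_entry_geP[|p p2k]; first lia.
  have /eqP p_c : p == val c.1 by rewrite -large; lia.
  move: p2k; rewrite p_c code_entryE eqxx.
  by have := ltn_ord (c.2 c.1); lia.
have [p large] := mem_card1 X1.
have {}large q : (k <= X q.1 q.2) = (q == p).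
  by have := large q; rewrite !inE -leqNgt.
have pp : p.1 < p.2.
  apply: (UN_gt1_lt (X := X)); apply: leq_trans k_gt1 _.
  by rewrite large.
have lt2k q : X q.1 q.2 < 2 * k.
  rewrite ltnNge; apply: contraTN X2k => ?.
  by rewrite -leqNgt; apply/max_entry_geP; [lia|exists q].
have k0 : 0 < k by exact: ltnW.
pose f := [ffun t : T => Ordinal (ltn_pmod (X (val t).1 (val t).2) k0)].
exists ((exist _ p pp : T), f) => //.
apply: val_inj; apply: UN_eqP => i j ij.
pose t : T := exist _ (i, j) ij.
rewrite -[i]/(val t).1 -[j]/(val t).2 code_entryE ffunE.
rewrite -[_ == _]/(p == (i, j)) /=.
have := large (i, j); have := lt2k (i, j) => /=.
rewrite [p == _]eq_sym; case: eqP => _ Xlt kX; last first.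
  by rewrite modn_small ?addn0 // ltnNge kX.
have -> : X i j = (X i j - k) + k by rewrite subnK.
by rewrite modnDr modn_small; lia.
Qed.

Lemma card_Uk : (Uk n k #= `I_('C(n, 2) * k ^ 'C(n, 2)))%card.
Proof.
rewrite Uk_eq_decode.
have -> : 'C(n, 2) * k ^ 'C(n, 2) = #|{: T * {ffun T -> 'I_k}}|.
  by rewrite card_prod card_ffun card_ord card_ltn_ord_pairs.
apply: card_eq_trans (card_esym card_II).
apply: card_eq_trans (inj_card_eq (in2W decode_inj)) _.
have <- : (enum_rank @` [set: code] = setT)%classic.
  by apply/seteqP; split=> // r _; exists (enum_val r); rewrite ?enum_valK.
by apply/card_esym/inj_card_eq => c d _ _; apply: enum_rank_inj.
Qed.

End Counting.

Theorem lemma2p11 (n k : nat) (hn : 2 <= n) (hk : 2 <= k) :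
  (forall G : set (UNk n k), minimal_generating_set G <-> G = Uk n k) /\
  embedding_dimension (UNk n k) ('C(n, 2) * k ^ 'C(n, 2)).
Proof.
(* [Uk] generates and lies inside every generating set, so it is the least one; this yields both
   uniqueness and the minimum cardinality. *)
have genU := @Uk_generating n k hk; have subU := @Uk_sub_generating n k hk.
split=> [G|].
  split=> [[genG minG]|->]; first by apply/esym/minG => //; apply: subU.
  by split=> // H HU genH; apply/seteqP; split=> //; apply: subU.
split; first by exists (Uk n k) => //; apply: card_Uk.
move=> G genG.
by rewrite -(card_le_eql (card_Uk n hk)); apply: subset_card_le; apply: subU.
Qed.
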